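(* Let $\xi>0$ be such that the matrix $D_\xi:=D^TD-\xi^2 I$ is non-singular. For $\omega\ge 0$, the matrix $G(j\omega)$ has a singular value equal to $\xi$ if and only if $\lambda=j\omega$ is a solution of the equation $\det H(\lambda,\xi)=0$, where $$H(\lambda,\xi):=\lambda I-M_0-\sum_{i=1}^m\left(M_ie^{-\lambda\tau_i}+M_{-i}e^{\lambda\tau_i}\right)-\left(N_1e^{-\lambda\tau_0}+N_{-1}e^{\lambda\tau_0}\right),$$ with $$M_0=\begin{bmatrix}A_0&-BD_\xi^{-1}B^T\\-C^TC+C^TDD_\xi^{-1}D^TC&-A_0^T\end{bmatrix},\quad M_i=\begin{bmatrix}A_i&0\\0&0\end{bmatrix},\quad M_{-i}=\begin{bmatrix}0&0\\0&-A_i^T\end{bmatrix}\ (1\le i\le m),$$ $$N_1=\begin{bmatrix}0&0\\0&C^TDD_\xi^{-1}B^T\end{bmatrix},\quad N_{-1}=\begin{bmatrix}-BD_\xi^{-1}D^TC&0\\0&0\end{bmatrix}.$$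
   Context: Here $j$ is the imaginary unit, $A_0,\dots,A_m\in\mathbb{R}^{n\times n}$, $B\in\mathbb{R}^{n\times n_u}$, $C\in\mathbb{R}^{n_y\times n}$, $D\in\mathbb{R}^{n_y\times n_u}$, and $\tau_0,\tau_1,\dots,\tau_m\ge 0$ are delays with $\max_{0\le i\le m}\tau_i=1$. The transfer function is $$G(j\omega)=C\Big(j\omega I-A_0-\sum_{i=1}^mA_ie^{-j\omega\tau_i}\Big)^{-1}B+De^{-j\omega\tau_0}.$$ Standing assumption (stability of $G$): all zeros $\lambda\in\mathbb{C}$ of $\det(\lambda I-A_0-\sum_{i=1}^mA_ie^{-\lambda\tau_i})=0$ lie in the open left half complex plane. *)

(* Defs.v *)
From HB Require Import structures.
From mathcomp Require Import all_boot all_order all_algebra.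
From mathcomp Require Import reals sequences exp trigo complex.

Set Implicit Arguments.
Unset Strict Implicit.
Unset Printing Implicit Defensive.

Import Order.TTheory GRing.Theory Num.Theory.

Local Open Scope ring_scope.
Local Open Scope complex_scope.
Local Open Scope sesquilinear_scope.

Definition cexp (R : realType) (z : R[i]) : R[i] :=
  (expR (complex.Re z))%:C *
  (cos (complex.Im z) +i* sin (complex.Im z)).

Definition toCmx (R : realType) (p q : nat) (A : 'M[R]_(p, q)) :
    'M[R[i]]_(p, q) :=
  map_mx (real_complex R) A.

(* For p < q this also counts 0 as a singular value of every A : 'M_(p, q);
   conventions on the number of singular values differ only in this respect. *)
Definition singular_value (R : realType) (p q : nat) (A : 'M[R[i]]_(p, q))
    (s : R) : bool :=
  (0 <= s) && eigenvalue (A ^t* *m A) (s%:C ^+ 2).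

(* The families A and tau are indexed by 0, ..., m: A 0 is the undelayed state
   matrix, whereas tau 0 is the delay of the feedthrough term D.  Sums over
   i = 1, ..., m are sums over i != ord0. *)

Definition char_mx (R : realType) (m n : nat) (A : 'I_m.+1 -> 'M[R]_n)
    (tau : 'I_m.+1 -> R) (lambda : R[i]) : 'M[R[i]]_n :=
  lambda%:M - toCmx (A ord0)
  - \sum_(i < m.+1 | i != ord0) cexp (- lambda * (tau i)%:C) *: toCmx (A i).

Definition stable (R : realType) (m n : nat) (A : 'I_m.+1 -> 'M[R]_n)
    (tau : 'I_m.+1 -> R) : Prop :=
  forall lambda : R[i], \det (char_mx A tau lambda) = 0 ->
    complex.Re lambda < 0.

Definition transfer (R : realType) (m n nu ny : nat)
    (A : 'I_m.+1 -> 'M[R]_n) (tau : 'I_m.+1 -> R)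
    (B : 'M[R]_(n, nu)) (C : 'M[R]_(ny, n)) (D : 'M[R]_(ny, nu))
    (lambda : R[i]) : 'M[R[i]]_(ny, nu) :=
  toCmx C *m invmx (char_mx A tau lambda) *m toCmx B
  + cexp (- lambda * (tau ord0)%:C) *: toCmx D.

Section Hamiltonian.

Variables (R : realType) (m n nu ny : nat).
Variables (A : 'I_m.+1 -> 'M[R]_n) (tau : 'I_m.+1 -> R).
Variables (B : 'M[R]_(n, nu)) (C : 'M[R]_(ny, n)) (D : 'M[R]_(ny, nu)).
Variable xi : R.

Definition Dxi : 'M[R]_nu := D^T *m D - (xi ^+ 2)%:M.

Definition M0 : 'M[R]_(n + n) :=
  block_mx
    (A ord0)
    (- (B *m invmx Dxi *m B^T))
    (- (C^T *m C) + C^T *m D *m invmx Dxi *m D^T *m C)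
    (- (A ord0)^T).

Definition Mpos (i : 'I_m.+1) : 'M[R]_(n + n) := block_mx (A i) 0 0 0.

Definition Mneg (i : 'I_m.+1) : 'M[R]_(n + n) := block_mx 0 0 0 (- (A i)^T).

Definition Npos : 'M[R]_(n + n) :=
  block_mx 0 0 0 (C^T *m D *m invmx Dxi *m B^T).

Definition Nneg : 'M[R]_(n + n) :=
  block_mx (- (B *m invmx Dxi *m D^T *m C)) 0 0 0.

Definition H (lambda : R[i]) : 'M[R[i]]_(n + n) :=
  lambda%:M - toCmx M0
  - \sum_(i < m.+1 | i != ord0)
      (cexp (- lambda * (tau i)%:C) *: toCmx (Mpos i)
       + cexp (lambda * (tau i)%:C) *: toCmx (Mneg i))
  - (cexp (- lambda * (tau ord0)%:C) *: toCmx Npos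
     + cexp (lambda * (tau ord0)%:C) *: toCmx Nneg).

End Hamiltonian.

(* Main.v *)
(* With P = jw I - A_0 - sum A_i e^(-jw tau_i), invertible by stability, H is a
   perturbation L + U W^-1 V, W = D_xi, of the lower block triangular matrix L
   with diagonal blocks P and - P^* and lower left block C^T C; here
   U = [B; - e^(-jw tau_0) C^T D] and V = [e^(jw tau_0) D^T C, B^T].
   Moreover W + V L^-1 U = G^* G - xi^2 I, so by the two Schur complement
   expansions det W * det H = det L * det (G^* G - xi^2 I). *)
Require Import Defs.
From mathcomp Require Import all_boot all_order all_algebra.
From mathcomp Require Import reals sequences exp trigo complex.

Set Implicit Arguments.
Unset Strict Implicit.
Unset Printing Implicit Defensive.

Import Order.TTheory GRing.Theory Num.Theory.

Local Open Scope ring_scope.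
Local Open Scope complex_scope.

Section BlockMatrices.

Variable F : comUnitRingType.

Lemma sum_block_diag_mx (I : finType) (p : pred I) (m1 m2 n1 n2 : nat)
    (X : I -> 'M[F]_(m1, n1)) (Y : I -> 'M[F]_(m2, n2)) :
  \sum_(i | p i) block_mx (X i) 0 0 (Y i)
  = block_mx (\sum_(i | p i) X i) 0 0 (\sum_(i | p i) Y i).
Proof.
elim/big_rec3: _ => [|i x y z _ ->]; first by rewrite block_mx0.
by rewrite add_block_mx !addr0.
Qed.

(* Both sides are the determinant of the block matrix [L, - U; V, W],
   expanded along either diagonal block. *)
Lemma det_schur (n k : nat) (L : 'M[F]_n) (W : 'M[F]_k)
    (U : 'M[F]_(n, k)) (V : 'M[F]_(k, n)) :
    L \in unitmx -> W \in unitmx ->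
  \det W * \det (L + U *m invmx W *m V)
  = \det L * \det (W + V *m invmx L *m U).
Proof.
move=> uL uW.
have eL : block_mx L (- U) V W = block_mx 1%:M 0 (V *m invmx L) 1%:M
    *m block_mx L (- U) 0 (W + V *m invmx L *m U).
  rewrite mulmx_block !mul1mx !mul0mx !addr0 mulmxKV // mulmxN.
  by rewrite addrC addrK.
have eW : block_mx L (- U) V W = block_mx 1%:M (- U *m invmx W) 0 1%:M
    *m block_mx (L + U *m invmx W *m V) 0 V W.
  rewrite mulmx_block !mul1mx !mul0mx !add0r mulmxKV //.
  by rewrite !mulNmx addrK.
transitivity (\det (block_mx L (- U) V W)).
  by rewrite eW det_mulmx det_ublock det_lblock !det1 !mul1r mulrC.
by rewrite eL det_mulmx det_ublock det_lblock !det1 !mul1r.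
Qed.

Lemma invmx_lblock (n k : nat) (P : 'M[F]_n) (Q : 'M[F]_k) (S : 'M[F]_(k, n)) :
    P \in unitmx -> Q \in unitmx ->
  invmx (block_mx P 0 S Q)
  = block_mx (invmx P) 0 (- (invmx Q *m S *m invmx P)) (invmx Q).
Proof.
move=> uP uQ; set L := block_mx P 0 S Q.
have uL : L \in unitmx by rewrite unitmxE det_lblock unitrM -!unitmxE uP.
(* Left multiplication by the invertible [L] is injective, so it suffices that [L] times the claimed
   inverse is the identity. *)
apply: (can_inj (mulKmx uL)); rewrite mulmxV // mulmx_block.
rewrite !mul0mx !mulmx0 !addr0 add0r !mulmxV // mulmxN !mulmxA mulmxV //.
by rewrite mul1mx subrr -scalar_mx_block.
Qed.

(* [Bt], [Ct], [Dt], [Q] stand for the adjoints of [B], [C], [D], [P]. *)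
Lemma det_hamiltonian (n nu ny : nat) (P Q : 'M[F]_n)
    (B : 'M[F]_(n, nu)) (C : 'M[F]_(ny, n)) (D : 'M[F]_(ny, nu))
    (Bt : 'M[F]_(nu, n)) (Ct : 'M[F]_(n, ny)) (Dt : 'M[F]_(nu, ny))
    (W : 'M[F]_nu) (e e' : F) :
    P \in unitmx -> Q \in unitmx -> W \in unitmx -> e * e' = 1 ->
  \det W * \det (block_mx
    (P + e *: (B *m invmx W *m Dt *m C)) (B *m invmx W *m Bt)
    (Ct *m C - Ct *m D *m invmx W *m Dt *m C)
    (- Q - e' *: (Ct *m D *m invmx W *m Bt)))
  = \det P * \det (- Q) *
    \det (W - Dt *m D
          + (Bt *m invmx Q *m Ct + e *: Dt) *m (C *m invmx P *m B + e' *: D)).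
Proof.
move=> uP uQ uW ee'.
have uNQ : - Q \in unitmx by rewrite -scaleN1r unitmxZ ?unitrN1.
have iNQ : invmx (- Q) = - invmx Q
  by rewrite -scaleN1r invmxZ ?invrN1 !scaleN1r.
pose L := block_mx P 0 (Ct *m C) (- Q).
have uL : L \in unitmx by rewrite unitmxE det_lblock unitrM -!unitmxE uP.
(* One product [U *m invmx W *m V] has to give all four perturbation blocks; the weights [- e'] and
   [e] cancel in the lower left one because [e * e' = 1]. *)
pose U := col_mx B (- e' *: (Ct *m D)).
pose V := row_mx (e *: (Dt *m C)) Bt.
have -> : block_mx (P + e *: (B *m invmx W *m Dt *m C)) (B *m invmx W *m Bt)
    (Ct *m C - Ct *m D *m invmx W *m Dt *m C)
    (- Q - e' *: (Ct *m D *m invmx W *m Bt)) = L + U *m invmx W *m V.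
  rewrite mul_col_mx mul_col_row add_block_mx add0r.
  rewrite -!scalemxAl -!scalemxAr !mulmxA scalerA mulNr [e' * e]mulrC ee'.
  by rewrite scaleN1r scaleNr.
rewrite det_schur // det_lblock; congr (_ * \det _).
(* Expanding the product on the right gives the terms of [V *m invmx L *m U] and, since
   [e * e' = 1], one extra [Dt *m D], which the subtracted [Dt *m D] cancels. *)
rewrite -addrA; congr (_ + _).
rewrite invmx_lblock // iNQ mul_row_block mul_row_col.
rewrite !mulmx0 add0r !mulNmx opprK mulmxDl mulmxDr !mulmxDl.
rewrite !mulmxN -!scalemxAl -!scalemxAr !mulNmx !mulmxA scalerA ee' scale1r.
rewrite scaleNr scalerN opprK.
by rewrite [RHS]addrC -!addrA subrr addr0 addrCA.
Qed.

End BlockMatrices.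

Lemma eigenvalue_det (F : fieldType) (n : nat) (M : 'M[F]_n) (a : F) :
  eigenvalue M a = (\det (M - a%:M) == 0).
Proof. by rewrite /eigenvalue kermx_eq0 row_free_unit unitmxE unitfE negbK. Qed.

Section ComplexMatrices.

Local Open Scope sesquilinear_scope.

Variable R : realType.

Lemma cexp_mulN (z : R[i]) : cexp z * cexp (- z) = 1.
Proof.
case: z => a b; rewrite /cexp /= cosN sinN mulrACA -rmorphM /= -expRD subrr expR0.
rewrite mul1r; apply/eqP; rewrite eq_complex /= mulrN opprK -!expr2 cos2Dsin2 eqxx /=.
by rewrite mulrN mulrC addNr.
Qed.

Lemma conj_real (x : R) : (x%:C)^*%R = x%:C.
Proof. exact: conjc_real. Qed.

Lemma conj_cexp (z : R[i]) : (cexp z)^*%R = cexp z^*%R.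
Proof.
case: z => a b; change ((cexp (a +i* b))^*%C = cexp (a -i* b)).
by rewrite /cexp rmorphM /= oppr0 cosN sinN.
Qed.

Lemma adj_toCmx (p q : nat) (X : 'M[R]_(p, q)) : (toCmx X)^t* = toCmx X^T.
Proof. by apply/matrixP=> i j; rewrite !mxE; exact: conj_real. Qed.

Lemma adj_mulmx (p q r : nat) (X : 'M[R[i]]_(p, q)) (Y : 'M[R[i]]_(q, r)) :
  (X *m Y)^t* = Y^t* *m X^t*.
Proof. by rewrite trmx_mul map_mxM. Qed.

Lemma adjZ (p q : nat) (z : R[i]) (X : 'M[R[i]]_(p, q)) :
  (z *: X)^t* = z^*%R *: X^t*.
Proof. by rewrite linearZ map_mxZ. Qed.

(** The [A i] and [tau i] are real, so conjugation only affects [z]. On the imaginary axis it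
    negates [z], turning the delays into the advances of the lower right block of [H]. *)
Lemma adj_char_mx (m n : nat) (A : 'I_m.+1 -> 'M[R]_n) (tau : 'I_m.+1 -> R)
    (z : R[i]) :
  (char_mx A tau z)^t* = (z^*%R)%:M - toCmx (A ord0)^T
    - \sum_(i < m.+1 | i != ord0) cexp (- z^*%R * (tau i)%:C) *: toCmx (A i)^T.
Proof.
rewrite /char_mx !linearB /= tr_scalar_mx !map_mxB map_scalar_mx adj_toCmx.
congr (_ - _); rewrite linear_sum /= map_mx_sum; apply: eq_bigr => i _.
by rewrite adjZ adj_toCmx conj_cexp rmorphM rmorphN /= conj_real.
Qed.

End ComplexMatrices.

Theorem lemma2p1 (R : realType) (m n nu ny : nat)
    (A : 'I_m.+1 -> 'M[R]_n) (tau : 'I_m.+1 -> R)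
    (B : 'M[R]_(n, nu)) (C : 'M[R]_(ny, n)) (D : 'M[R]_(ny, nu))
    (tau_ge0 : forall i, 0 <= tau i)
    (tau_max : \big[Num.max/0]_(i < m.+1) tau i = 1)
    (Gstable : stable A tau)
    (xi : R) (xi_gt0 : 0 < xi) (Dxi_unit : Dxi D xi \in unitmx)
    (omega : R) (omega_ge0 : 0 <= omega) :
  singular_value (transfer A tau B C D (0 +i* omega)) xi
  <-> \det (H A tau B C D xi (0 +i* omega)) = 0.
Proof.
set z := 0 +i* omega; set P := char_mx A tau z.
pose Q := map_mx Num.conj P^T.
pose W := toCmx (Dxi D xi).
pose e := cexp (z * (tau ord0)%:C); pose e' := cexp (- z * (tau ord0)%:C).
have ee' : e * e' = 1 by rewrite /e /e' mulNr cexp_mulN.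
have zJ : z^*%R = - z by apply/eqP; rewrite eq_complex /= oppr0 !eqxx.
have e'J : e'^*%R = e by rewrite conj_cexp rmorphM rmorphN /= zJ opprK conj_real.
have uW : W \in unitmx by rewrite map_unitmx.
have uP : P \in unitmx.
  (* A vanishing determinant would force the real part of [z], which is 0, to be negative. *)
  rewrite unitmxE unitfE; apply/eqP => /Gstable /=.
  by rewrite ltxx.
have uQ : Q \in unitmx by rewrite map_unitmx unitmx_tr.
(* The exponentials occur only in the diagonal blocks: the delayed terms complete [z - A_0] to [P],
   the advanced ones [z + A_0^T] to [- Q]. *)
have HE : H A tau B C D xi z = block_mx
    (P + e *: (toCmx B *m invmx W *m toCmx D^T *m toCmx C))
    (toCmx B *m invmx W *m toCmx B^T)
    (toCmx C^T *m toCmx C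
       - toCmx C^T *m toCmx D *m invmx W *m toCmx D^T *m toCmx C)
    (- Q - e' *: (toCmx C^T *m toCmx D *m invmx W *m toCmx B^T)).
  rewrite /H /toCmx /M0 /Npos /Nneg.
  under eq_bigr => i _ do
    rewrite !map_block_mx !map_mx0 !scale_block_mx !scaler0 add_block_mx !add0r !addr0.
  rewrite sum_block_diag_mx !map_block_mx !map_mx0 !scale_block_mx !scaler0.
  rewrite add_block_mx !add0r !addr0 scalar_mx_block !opp_block_mx !add_block_mx.
  rewrite !oppr0 !add0r !addr0.
  rewrite !map_mxN !map_mxD !map_mxN !map_mxM /= !map_invmx opprK -!/(toCmx _) -/W -/e -/e'.
  congr block_mx.
  - by rewrite scalerN opprK.
  - by rewrite opprD opprK.
  rewrite /Q adj_char_mx zJ.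
  rewrite !opprD !opprK raddfN opprK.
  congr (_ - _).
  congr (_ + _); rewrite -sumrN; apply: eq_bigr => i _.
  by rewrite map_mxN scalerN opprK.
(* The adjoint of G is the left factor in [det_hamiltonian]: adjoints commute with inverses, and
   [e'] has conjugate [e]. *)
have GE : map_mx Num.conj (transfer A tau B C D z)^T
    = toCmx B^T *m invmx Q *m toCmx C^T + e *: toCmx D^T.
  rewrite /transfer linearD /= map_mxD -/P -/e' adjZ e'J adj_toCmx.
  by rewrite !adj_mulmx !adj_toCmx trmx_inv map_invmx mulmxA.
have := det_hamiltonian (toCmx B) (toCmx C) (toCmx D) (toCmx B^T) (toCmx C^T)
  (toCmx D^T) uP uQ uW ee'.
rewrite -HE -GE.
have -> : W - toCmx D^T *m toCmx D = - (xi%:C ^+ 2)%:M.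
  by rewrite /W /Dxi /toCmx map_mxB map_mxM map_scalar_mx addrC addKr rmorphXn.
rewrite addrC => detE.
have nz k (M : 'M[R[i]]_k) : M \in unitmx -> (\det M == 0) = false.
  by rewrite unitmxE unitfE => /negbTE.
have nzNQ : (\det (- Q) == 0) = false.
  by rewrite -scaleN1r detZ mulf_eq0 signr_eq0 nz.
rewrite /singular_value (ltW xi_gt0) eigenvalue_det /=.
(* The determinants of [W], [P] and [- Q] are nonzero, so the two remaining factors vanish
   together. *)
move/(congr1 (eq_op^~ 0)): detE.
rewrite !mulf_eq0 nzNQ (nz _ _ uW) (nz _ _ uP) /= => <-.
by split=> /eqP.
Qed.
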